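(* Let $d\geq 2$, let $\Lambda\subset\mathbb{R}^d$ be a unimodular lattice with dual lattice $\Lambda^\ast$, and let $f(\pmb\tau)=|\pmb\tau|_+$ on $\mathcal{T}$. Then \[\underline{\Psi}_1(\Lambda,f)\leq\frac{\underline{\Psi}_2(\Lambda,f)}{2}\leq\ldots\leq\frac{\underline{\Psi}_k(\Lambda,f)}{k}\leq\ldots\leq\frac{\underline{\Psi}_{d-1}(\Lambda,f)}{d-1}\leq\frac{\underline{\Psi}_1(\Lambda^\ast,f)}{(d-1)^2}.\]
   Context: $|\cdot|$ denotes the sup-norm on $\mathbb{R}^d$, and $\mathcal{B}=\{\vec x\in\mathbb{R}^d: |\vec x|\leq 1\}$. Let $\mathcal{T}=\{\pmb\tau=(\tau_1,\ldots,\tau_d)\in\mathbb{R}^d:\ \tau_1+\ldots+\tau_d=0\}$ and $|\pmb\tau|_+=\max_{1\leq k\leq d}\tau_k$. For $\pmb\tau\in\mathcal{T}$ put $D_{\pmb\tau}=\mathrm{diag}(e^{\tau_1},\ldots,e^{\tau_d})$ and $\mathcal{B}_{\pmb\tau}=D_{\pmb\tau}\mathcal{B}$. For a lattice $\Gamma$, $\lambda_k(\mathcal{B}_{\pmb\tau},\Gamma)$ is the $k$-th successive minimum (the infimum of $\lambda>0$ such that $\lambda\mathcal{B}_{\pmb\tau}$ contains $k$ linearly independent vectors of $\Gamma$), $L_k(\pmb\tau,\Gamma)=\log\lambda_k(\mathcal{B}_{\pmb\tau},\Gamma)$, and $\underline{\Psi}_k(\Gamma,f)=\liminf_{|\pmb\tau|\to\infty,\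 \pmb\tau\in\mathcal{T}}\sum_{j=1}^k L_j(\pmb\tau,\Gamma)/f(\pmb\tau)$. The dual lattice is $\Lambda^\ast=\{\vec y\in\mathbb{R}^d:\ \langle\vec y,\vec x\rangle\in\mathbb{Z}\text{ for all }\vec x\in\Lambda\}$. A lattice is unimodular if its covolume is $1$. *)

(* Defs.v *)
From HB Require Import structures.
From mathcomp Require Import all_boot all_order all_algebra.
From mathcomp Require Import all_classical all_reals all_analysis.

Set Implicit Arguments.
Unset Strict Implicit.
Unset Printing Implicit Defensive.

Import Order.TTheory GRing.Theory Num.Theory.
Import numFieldNormedType.Exports.

Local Open Scope classical_set_scope.
Local Open Scope ring_scope.

(* Vectors of R^d are rows; `|x| on 'rV[R]_d is the library norm mx_norm, i.e.
   the sup-norm. *)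

Section Lattices.
Variables (R : realType) (d : nat).
Implicit Types (G : set 'rV[R]_d) (B : 'M[R]_d).

(* The rows of B are linearly independent and G is the set of their integer
   combinations. *)
Definition lattice_basis G B : Prop :=
  B \in unitmx /\
  G = [set map_mx intr z *m B | z in [set: 'rV[int]_d]].

(* The covolume of a lattice is `|\det B| for any of its bases B. *)
Definition unimodular_lattice G : Prop :=
  exists2 B, lattice_basis G B & `|\det B| = 1.

Definition dual_lattice G : set 'rV[R]_d :=
  [set y | forall x, G x -> \sum_(i < d) y 0 i * x 0 i \is a Num.int].

Definition sup_ball : set 'rV[R]_d := [set x | `|x| <= 1].

Definition zero_sum : set 'rV[R]_d := [set tau | \sum_(i < d) tau 0 i = 0].

(* For d > 0 this is a supremum over a nonempty finite set, hence a maximum. *)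
Definition max_coord (tau : 'rV[R]_d) : R := sup (range (fun k => tau 0 k)).

Definition diag_exp (tau : 'rV[R]_d) : 'M[R]_d := diag_mx (map_mx expR tau).

Definition box (tau : 'rV[R]_d) : set 'rV[R]_d :=
  [set x *m diag_exp tau | x in sup_ball].

Definition successive_min (K G : set 'rV[R]_d) (k : nat) : R :=
  inf [set lam : R | 0 < lam /\
    exists2 V : 'M[R]_(k, d), row_free V &
      forall i, G (row i V) /\ [set lam *: x | x in K] (row i V)].

Definition log_min (k : nat) (tau : 'rV[R]_d) G : R :=
  ln (successive_min (box tau) G k).

Definition norm_pinfty : set_system 'rV[R]_d :=
  [set A | exists M : R, forall tau, M < `|tau| -> A tau].

Definition lower_Psi (k : nat) G (f : 'rV[R]_d -> R) : \bar R :=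
  limf_einf
    (fun tau => ((\sum_(1 <= j < k.+1) log_min j tau G) / f tau)%:E)
    (within zero_sum norm_pinfty).

End Lattices.

(* Main.v *)
(** The first inequalities hold because [L_1 <= ... <= L_d], so that the means
    [(L_1 + ... + L_k) / k] increase with [k].  For the last one, write [L_k]
    for [Lambda] at [tau] and [L*_1] for the dual lattice at [- tau].  The
    upper bound of Minkowski's second theorem, with an unspecified constant,
    gives [L_1 + ... + L_d <= O(1)] and [L*_1 <= O(1)], and pairing a short
    dual vector with [d] independent lattice vectors gives
    [- L_d <= L*_1 + O(1)]; hence [L_1 + ... + L_(d-1) <= L*_1 + O(1)].  As
    [L*_1] is bounded above and [|tau|_+ <= (d - 1) |- tau|_+], replacing the
    denominator [|tau|_+] by [|- tau|_+] costs at most the factor [d - 1] in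
    the lower limit. *)

Require Import Defs.
From mathcomp Require Import all_boot all_order all_algebra.
From mathcomp Require Import all_classical all_reals all_analysis.
From mathcomp Require Import ring lra.

Set Implicit Arguments.
Unset Strict Implicit.
Unset Printing Implicit Defensive.

Import Order.TTheory GRing.Theory Num.Theory.
Import numFieldNormedType.Exports.

Local Open Scope classical_set_scope.
Local Open Scope ring_scope.

(** * Short lattice vectors with a bounded product of norms *)

Section Reduction.
Variable R : realType.

Lemma row_norm_leP n (x : 'rV[R]_n) (r : R) : 0 <= r ->
  reflect (forall j, `|x 0 j| <= r) (`|x| <= r).
Proof.
move=> r0; apply: (iffP idP) => [xr j | xr].
  apply: le_trans xr; rewrite /Num.norm/= mx_normrE.
  exact: (le_bigmax _ (fun ij : 'I_1 * 'I_n => `|x ij.1 ij.2|) (0, j)).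
rewrite /Num.norm/= mx_normrE; apply: bigmax_le => // -[i j] _ /=.
by rewrite (ord1 i).
Qed.

Lemma row_norm_coord n (x : 'rV[R]_n) j : `|x 0 j| <= `|x|.
Proof. exact: (row_norm_leP x (normr_ge0 x) (lexx _)). Qed.

Lemma row_norm_attained n (x : 'rV[R]_n) : x != 0 -> exists j, `|x 0 j| = `|x|.
Proof.
move=> x0; have /mx_norm_neq0[[i j] /= e] : mx_norm x != 0.
  by apply: contra x0 => /eqP /mx_norm_eq0 ->.
by exists j; rewrite [RHS]e (ord1 i).
Qed.

(** Each coordinate of [z] is recovered from [z B] through [invmx B], and a nonzero integer
    coordinate has absolute value at least 1. *)
Lemma lattice_norm_lb n (B : 'M[R]_n) : B \in unitmx ->
  exists2 c : R, 0 < c &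
    forall z : 'rV[int]_n, z != 0 -> c <= `|map_mx intr z *m B|.
Proof.
move=> uB; pose S : R := 1 + \sum_i \sum_j `|invmx B i j|.
have S0 : 0 < S.
  by apply: ltr_pwDl => //; apply: sumr_ge0 => i _; apply: sumr_ge0.
exists S^-1; first by rewrite invr_gt0.
move=> z z0; set x := map_mx intr z *m B.
have [j zj] : exists j, z 0 j != 0.
  apply/existsP; apply: contraR z0; rewrite negb_exists => /forallP h.
  by apply/eqP/rowP => j; rewrite mxE; apply/eqP; have := h j; rewrite negbK.
have e : (z 0 j)%:~R = \sum_i x 0 i * invmx B i j.
  have : x *m invmx B = map_mx intr z by rewrite /x mulmxK.
  by move/rowP/(_ j); rewrite !mxE => <-.
rewrite -[S^-1]mul1r ler_pdivrMr //.
have /le_trans : 1 <= `|(z 0 j)%:~R : R|.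
  by rewrite norm_intr_ge1 ?intr_eq0 ?intr_int.
apply; rewrite e.
apply: le_trans (ler_norm_sum _ _ _) _.
rewrite mulrDr mulr1 -[leLHS]add0r; apply: lerD => //.
rewrite mulr_sumr; apply: ler_sum => i _; rewrite normrM.
apply: ler_pM => //; first exact: row_norm_coord.
by rewrite (bigD1 j) //= lerDl sumr_ge0.
Qed.

(** In the Smith normal form of the one-row matrix [z], the diagonal factor vanishes off its first
    entry, so only row 0 of the invertible right factor survives. *)
Lemma unimodular_completion n (z : 'rV[int]_n.+1) : z != 0 ->
  exists (c : int) (G : 'M[int]_n.+1),
    [/\ G \in unitmx, c != 0 & z = c *: row 0 G].
Proof.
move=> z0; have [L _ [G uG [d _ e]]] := int_Smith_normal_form z.
have ez : z = (L 0 0 * d`_0) *: row 0 G.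
  rewrite e; apply/rowP => j; rewrite !mxE big_ord_recl big1 ?addr0.
    by rewrite !mxE big_ord1 !mxE eqxx mulr1n.
  by move=> i _; rewrite !mxE big_ord1 !mxE /= mulr0n mulr0 mul0r.
exists (L 0 0 * d`_0), G; split => //.
by apply: contraNneq z0 => c0; rewrite ez c0 scale0r.
Qed.

(** Clear column [p] with the pivot in row 0, then expand along that column. The smaller matrix
    holds the projections of the other rows along row 0 onto the hyperplane where coordinate [p]
    vanishes. *)
Lemma det_pivot n (B : 'M[R]_n.+1) (p : 'I_n.+1) : B 0 p != 0 ->
  `|\det B| = `|B 0 p| * `|\det (\matrix_(i < n, j < n)
    (B (lift 0 i) (lift p j) - B (lift 0 i) p / B 0 p * B 0 (lift p j)))|.
Proof.
move=> b0.
pose E : 'M[R]_n.+1 := \matrix_(i, k)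
  ((i == k)%:R - ((k == 0) && (i != 0))%:R * (B i p / B 0 p)).
have dE : \det E = 1.
  rewrite det_trig.
    apply: big1 => i _; rewrite mxE eqxx.
    by case: (i == 0); rewrite ?mul0r ?subr0.
  apply/is_trig_mxP => i j ij; rewrite mxE.
  have -> : (i == j) = false by apply/negbTE; rewrite neq_ltn ij.
  have -> : (j == 0) = false.
    by apply/negbTE/eqP => j0; move: ij; rewrite j0.
  by rewrite mul0r subr0.
have EB i j : (E *m B) i j = B i j - (i != 0)%:R * (B i p / B 0 p) * B 0 j.
  rewrite mxE; under eq_bigr do rewrite mxE mulrBl.
  rewrite sumrB; congr (_ - _).
    rewrite (bigD1 i) //= eqxx mul1r big1 ?addr0 // => k /negbTE ki.
    by rewrite eq_sym ki mul0r.
  rewrite (bigD1 0) //= big1 ?addr0 // => k /negbTE k0.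
  by rewrite k0 !mul0r.
rewrite -[\det B]mul1r -dE -det_mulmx (expand_det_col _ p) (bigD1 0) //=.
rewrite big1 ?addr0; last first.
  by move=> i i0; rewrite EB i0 mul1r divfK // subrr mul0r.
rewrite EB eqxx /= !mul0r subr0 normrM /cofactor normrM normrX normrN1 expr1n.
rewrite mul1r; congr (_ * `|\det _|); apply/matrixP => i j.
have := EB (lift 0 i) (lift p j); rewrite mxE /= mul1r => e.
by rewrite !mxE e.
Qed.

Lemma norm_det_unitz n (G : 'M[int]_n) : G \in unitmx ->
  `|\det (map_mx intr G : 'M[R]_n)| = 1.
Proof.
rewrite unitmxE => uG; rewrite det_map_mx /= -intr_norm.
by case/orP: uG => /eqP->; rewrite ?normrN1 ?normr1.
Qed.


(* A form of the upper bound of Minkowski's second theorem.  Induction on [n]: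
   take an almost shortest vector [b] of the lattice, complete it to a basis,
   project along [b] onto the hyperplane where the largest coordinate of [b]
   vanishes, and lift the reduced vectors of the projected lattice so that
   their component along [b] is at most [1/2].  Since no lattice vector is much
   shorter than [b], lifting enlarges them by a bounded factor only.  The norms
   need not be sorted, hence the nondecreasing majorant [r]. *)
Lemma reduced_vectors n : exists2 C : R, 0 < C &
  forall B : 'M[R]_n, B \in unitmx ->
  exists (U : 'M[int]_n) (r : 'I_n -> R),
    [/\ \det U != 0,
        forall i, `|map_mx intr (row i U) *m B| <= r i,
        {homo r : i j / (i <= j)%N >-> i <= j} &
        \prod_i r i <= C * `|\det B|].
Proof.
elim: n => [|n [C C0 IH]].
  exists 1 => // B _; exists 0, (fun=> 0); split.
  - by rewrite det_mx00.
  - by case.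
  - by case.
  - by rewrite big_ord0 det_mx00 normr1 mulr1.
exists (6 ^+ n * C); first by rewrite mulr_gt0 // exprn_gt0.
move=> B uB.
have [c c0 lbc] := lattice_norm_lb uB.
pose E : set R :=
  [set `|map_mx intr z *m B| | z in [set z : 'rV[int]_n.+1 | z != 0]].
have E0 : E !=set0.
  exists `|map_mx intr (delta_mx 0 0 : 'rV[int]_n.+1) *m B|.
  exists (delta_mx 0 0) => //=.
  by apply/eqP => /rowP/(_ 0); rewrite !mxE.
have lbE : lbound E c by move=> _ [z /= z0 <-]; exact: lbc.
set m0 := inf E.
have m00 : 0 < m0 by apply: lt_le_trans (lb_le_inf E0 lbE).
have m0_le (z : 'rV[int]_n.+1) : z != 0 -> m0 <= `|map_mx intr z *m B|.
  by move=> z0; apply: ge_inf; [exists c | exists z].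
(* The infimum is not shown to be attained; a vector shorter than [3/2 * m0] is enough. *)
have [_ [z /= z0 <-] zm] : exists2 e, E e & e < m0 + m0 / 2.
  by apply: inf_adherent; [lra | split => //; exists c].
have [a [G [uG a0 ez]]] := unimodular_completion z0.
have G0 : row 0 G != 0 by apply: contraNneq z0 => e; rewrite ez e scaler0.
set b := map_mx intr (row 0 G) *m B.
set m := `|b|.
have mm0 : m0 <= m by exact: m0_le.
(* As [z] is a nonzero integer multiple of row 0 of [G], the vector [b] is no longer than that of
   [z]. *)
have mm1 : m < m0 + m0 / 2.
  apply: le_lt_trans zm; rewrite ez map_mxZ -scalemxAl normrZ /=.
  by rewrite ler_peMl ?normr_ge0 // norm_intr_ge1 ?intr_int ?intr_eq0.
have mgt0 : 0 < m by lra.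
have [p bp] : exists p, `|b 0 p| = m.
  by apply: row_norm_attained; rewrite -normr_gt0.
set B1 := map_mx intr G *m B.
have bE j : b 0 j = B1 0 j by rewrite /b /B1 map_row -row_mul mxE.
have B1p : B1 0 p != 0 by rewrite -bE -normr_gt0 bp.
have dB : `|\det B1| = `|\det B|.
  by rewrite det_mulmx normrM norm_det_unitz // mul1r.
have := det_pivot B1p; rewrite dB -bE bp; set A : 'M[R]_n := \matrix_(i, j) _.
move=> dA.
have AE k j : A k j = B1 (lift 0 k) (lift p j)
    - B1 (lift 0 k) p / b 0 p * b 0 (lift p j) by rewrite [LHS]mxE !bE.
have uA : A \in unitmx.
  rewrite unitmxE unitfE -normr_eq0; apply/eqP => A0.
  by move: uB; rewrite unitmxE unitfE -normr_eq0 dA A0 mulr0 eqxx.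
have [U' [r' [dU' r'P r'_le r'C]]] := IH A uA.
(* [s i] is the component along [b] of the lift of the [i]-th reduced vector; adding [t i 0] copies
   of [b] brings it into [-1/2, 1/2]. *)
pose s i : R := \sum_k (U' i k)%:~R * B1 (lift 0 k) p / b 0 p.
pose t : 'cV[int]_n := \col_i - Num.floor (s i + 2^-1).
pose U1 : 'M[int]_(1 + n) := block_mx 1 0 t U'.
have tP i : `|(t i 0)%:~R + s i| <= 2^-1.
  rewrite mxE mulrNz; have := floor_itv (s i + 2^-1).
  rewrite intrD ler_norml; lra.
have dU1 : \det U1 != 0 by rewrite det_lblock det1 mul1r.
pose U : 'M[int]_n.+1 := U1 *m G.
have dU : \det U != 0.
  rewrite det_mulmx mulf_neq0 //; move: uG; rewrite unitmxE.
  by apply: contraTneq => ->; rewrite unitr0.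
have rowU0 i : row i U != 0.
  apply: contraNneq dU => e; rewrite (expand_det_row _ i) big1 // => j _.
  by move/rowP/(_ j): e; rewrite !mxE => ->; rewrite mul0r.
have UB i : map_mx intr (row i U) *m B = row i (map_mx intr U1 *m B1).
  by rewrite /B1 mulmxA -map_mxM -/U map_row row_mul.
have U1ul : U1 0 0 = 1.
  by have := block_mxEul 1 0 t U' 0 0; rewrite lshift0 [RHS]mxE.
have U1ur k : U1 0 (lift 0 k) = 0.
  by have := block_mxEur 1 0 t U' 0 k; rewrite lshift0 rshift1 [RHS]mxE.
have U1dl i : U1 (lift 0 i) 0 = t i 0.
  by have := block_mxEdl 1 0 t U' i 0; rewrite lshift0 rshift1.
have U1dr i k : U1 (lift 0 i) (lift 0 k) = U' i k.
  by have := block_mxEdr 1 0 t U' i k; rewrite !rshift1.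
have U0 : map_mx intr (row 0 U) *m B = b.
  rewrite UB; apply/rowP => j; rewrite bE mxE mxE big_ord_recl big1 => [|k _].
    by rewrite addr0 mxE U1ul mul1r.
  by rewrite mxE U1ur mul0r.
have UE i j : (map_mx intr (row (lift 0 i) U) *m B) 0 j =
    ((t i 0)%:~R + s i) * b 0 j + \sum_k (U' i k)%:~R *
      (B1 (lift 0 k) j - B1 (lift 0 k) p / b 0 p * b 0 j).
  rewrite UB mxE mxE big_ord_recl mxE U1dl -bE mulrDl -addrA.
  congr (_ + _).
  rewrite /s mulr_suml -big_split /=; apply: eq_bigr => k _.
  rewrite mxE U1dr; ring.
have vle i : `|map_mx intr (row (lift 0 i) U) *m B| <= m / 2 + r' i.
  have r'0 : 0 <= r' i by apply: le_trans (r'P i).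
  apply/row_norm_leP; first lra.
  move=> j; rewrite UE; apply: le_trans (ler_normD _ _) _; apply: lerD.
    rewrite normrM mulrC; apply: ler_pM => //; exact: row_norm_coord.
  case: (unliftP p j) => [j' ->|->].
    apply: le_trans (r'P i); apply: le_trans (row_norm_coord _ j').
    rewrite [X in _ <= `|X|]mxE le_eqVlt; apply/orP; left; apply/eqP; congr `|_|.
    by apply: eq_bigr => k _; rewrite AE; congr (_ * _); rewrite !mxE.
  rewrite big1 ?normr0 // => k _.
  by rewrite divfK ?subrr ?mulr0 // bE.
(* From [m < 3/2 * m0] and [m0 <= m / 2 + r' i]. Hence [m] followed by the [6 * r' i] is
   nondecreasing and still bounds the lifted vectors. *)
have r'm i : m <= 6 * r' i.
  by have := m0_le _ (rowU0 (lift 0 i)); have := vle i; lra.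
exists U, (fun i => if unlift 0 i is Some j then 6 * r' j else m); split => //.
- move=> i; case: unliftP => [j ->|->]; last by rewrite U0.
  by have := vle j; have := r'm j; lra.
- move=> i j; case: unliftP => [i' ->|->]; case: unliftP => [j' ->|->] //.
  by rewrite ler_pM2l // => /r'_le.
- rewrite big_ord_recl unlift_none dA.
  under eq_bigr do rewrite liftK.
  rewrite big_split /= prodr_const card_ord.
  have -> : 6 ^+ n * C * (m * `|\det A|) = m * (6 ^+ n * (C * `|\det A|)).
    by ring.
  by rewrite ler_pM2l // ler_pM2l ?exprn_gt0.
Qed.

End Reduction.

(** * Successive minima: positivity, Minkowski's upper bound, duality *)

Section SuccessiveMinima.
Variables (R : realType) (d : nat).
Implicit Types (G : set 'rV[R]_d) (B : 'M[R]_d) (tau : 'rV[R]_d).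

(** The set whose infimum is [successive_min], with membership in the dilated box spelled out by
    coordinates. *)
Definition admissible tau G (k : nat) : set R :=
  [set lam : R | 0 < lam /\
    exists2 V : 'M[R]_(k, d), row_free V &
      forall i, G (row i V) /\ (forall j, `|V i j| <= lam * expR (tau 0 j))].

Lemma scaled_boxP tau (lam : R) (x : 'rV[R]_d) : 0 < lam ->
  [set lam *: y | y in box tau] x <->
  forall j, `|x 0 j| <= lam * expR (tau 0 j).
Proof.
move=> lam0; split=> [[_ [y /= y1 <-] <-] j | xle].
  rewrite mxE mul_mx_diag !mxE !normrM (gtr0_norm lam0) (gtr0_norm (expR_gt0 _)).
  rewrite ler_pM2l // ler_piMl ?expR_ge0 //.
  exact: le_trans (row_norm_coord y j) y1.
exists ((\row_j (x 0 j / (lam * expR (tau 0 j)))) *m diag_exp tau).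
  exists (\row_j (x 0 j / (lam * expR (tau 0 j)))) => //=.
  apply/row_norm_leP => // j; rewrite mxE normrM normfV.
  have pos : 0 < lam * expR (tau 0 j) by rewrite mulr_gt0 ?expR_gt0.
  by rewrite [X in _ / X]gtr0_norm // ler_pdivrMr // mul1r.
apply/rowP => j; rewrite mxE mul_mx_diag !mxE.
field; by rewrite !gt_eqF ?expR_gt0.
Qed.

Lemma successive_minE tau G k :
  successive_min (box tau) G k = inf (admissible tau G k).
Proof.
congr inf; apply/seteqP; split => lam [lam0 [V fV VP]]; split => //;
    exists V => // i; have [Gi Vi] := VP i; split => //.
  by move=> j; have /scaled_boxP/(_ j) := Vi; rewrite mxE; apply.
by apply/scaled_boxP => // j; rewrite mxE.
Qed.

Lemma row_free_rowsub m n k (f : 'I_k -> 'I_m) (A : 'M[R]_(m, n)) :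
  injective f -> row_free A -> row_free (rowsub f A).
Proof.
move=> injf /row_freeP[X AX]; apply/row_freeP; exists (colsub f X).
apply/matrixP => i j; move/matrixP/(_ (f i) (f j)): AX.
rewrite !mxE (inj_eq injf) => <-; apply: eq_bigr => l _; by rewrite !mxE.
Qed.

Lemma admissible_le tau G k l : (k <= l)%N ->
  admissible tau G l `<=` admissible tau G k.
Proof.
move=> kl lam [lam0 [V fV VP]]; split => //.
exists (rowsub (widen_ord kl) V).
  by apply: row_free_rowsub => // i j /(congr1 val) /= ij; apply: val_inj.
move=> i; have [Gi Vi] := VP (widen_ord kl i); split.
  by rewrite row_rowsub.
by move=> j; rewrite mxE.
Qed.

Lemma admissible_lbound tau G k : has_lbound (admissible tau G k).
Proof. by exists 0 => lam [/ltW]. Qed.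

Lemma successive_min_le tau G k lam :
  admissible tau G k lam -> successive_min (box tau) G k <= lam.
Proof. by rewrite successive_minE; apply: ge_inf; exact: admissible_lbound. Qed.

(** This keeps the minima away from 0, where [ln] only has a default value. *)
Lemma lattice_admissible_gt0 G B tau : lattice_basis G B ->
  exists2 c : R, 0 < c &
    forall k lam, (0 < k)%N -> admissible tau G k lam -> c <= lam.
Proof.
move=> [uB GB]; have uD : diag_exp (- tau) \in unitmx.
  rewrite unitmxE unitfE det_diag; apply/prodf_neq0 => i _.
  by rewrite !mxE gt_eqF ?expR_gt0.
have [|c c0 cP] := @lattice_norm_lb R d (B *m diag_exp (- tau)).
  by rewrite unitmx_mul uB.
exists c => // k lam k0 [lam0 [V fV VP]].
have [Gi Vi] := VP (Ordinal k0); move: Gi; rewrite GB => -[z _ zE].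
have z0 : z != 0.
  apply/eqP => z0; have /row_freeP[X VX] := fV; have := congr1 (row (Ordinal k0)) VX.
  rewrite row_mul -zE z0 map_mx0 !mul0mx => /rowP/(_ (Ordinal k0)).
  by rewrite !mxE eqxx => /esym/eqP; rewrite oner_eq0.
apply: le_trans (cP z z0) _; rewrite mulmxA zE.
apply/row_norm_leP; first exact: ltW.
move=> j; rewrite mul_mx_diag !mxE normrM (gtr0_norm (expR_gt0 _)).
by rewrite expRN ler_pdivrMr ?expR_gt0.
Qed.

(* The columns of the basis are scaled by [expR (- tau)], which turns the box
   into the unit ball. *)
Lemma lattice_admissible_prod : exists2 C : R, 0 < C &
  forall G B tau, lattice_basis G B ->
  exists r : 'I_d -> R, (forall i : 'I_d, admissible tau G i.+1 (r i)) /\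
    (`|\det B| = 1 -> zero_sum tau -> \prod_i r i <= C).
Proof.
have [C C0 CP] := reduced_vectors R d; exists C => // G B tau [uB GB].
have dD : \det (diag_exp (- tau)) = expR (- \sum_i tau 0 i).
  rewrite det_diag -sumrN expR_sum; apply: eq_bigr => i _; by rewrite !mxE.
have [|U [r [dU rP r_le rC]]] := CP (B *m diag_exp (- tau)).
  by rewrite unitmx_mul uB unitmxE unitfE dD gt_eqF ?expR_gt0.
have uUB : map_mx intr U *m B \in unitmx.
  rewrite unitmx_mul uB andbT unitmxE unitfE det_map_mx /=.
  by rewrite intr_eq0.
have ler i j : `|(map_mx intr U *m B) i j| <= r i * expR (tau 0 j).
  have := le_trans (row_norm_coord _ j) (rP i).
  rewrite mulmxA mul_mx_diag mxE map_row -row_mul !mxE normrM.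
  by rewrite (gtr0_norm (expR_gt0 _)) expRN ler_pdivrMr ?expR_gt0.
have r0 i : 0 < r i.
  rewrite lt_neqAle (le_trans _ (rP i)) // andbT eq_sym; apply/eqP => ri.
  move: uUB; rewrite unitmxE unitfE => /eqP; apply.
  rewrite (expand_det_row _ i) big1 // => j _.
  have := ler i j; rewrite ri mul0r normr_le0 => /eqP ->; by rewrite mul0r.
exists r; split.
  move=> i; split => //.
  exists (rowsub (widen_ord (ltn_ord i)) (map_mx intr U *m B)).
    apply: row_free_rowsub; last by rewrite row_free_unit.
    by move=> j k /(congr1 val) /= jk; apply: val_inj.
  move=> k; split.
    rewrite row_rowsub GB; exists (row (widen_ord (ltn_ord i) k) U) => //.
    by rewrite map_row row_mul.
  move=> j; rewrite mxE; apply: le_trans (ler _ _) _.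
  by rewrite ler_pM2r ?expR_gt0 //; apply: r_le; rewrite -ltnS; exact: ltn_ord k.
move=> dB tau0; apply: le_trans rC _.
rewrite det_mulmx normrM dB mul1r dD.
by move: tau0; rewrite /zero_sum /= => ->; rewrite oppr0 expR0 normr1 mulr1.
Qed.

(** Needed for lower bounds on the minima, since [inf] of the empty set is a default value. *)
Lemma lattice_admissible_nonempty G B tau k :
  lattice_basis G B -> (k <= d)%N -> admissible tau G k !=set0.
Proof.
move=> GB; have [C _ /(_ G B tau GB)[r [rP _]]] := lattice_admissible_prod.
case: k => [_|k kd]; last by exists (r (Ordinal kd)); exact: (rP (Ordinal kd)).
exists 1; split => //; exists (0 : 'M[R]_(0, d)); last by case.
by rewrite /row_free mxrank0.
Qed.

Lemma successive_min_gt0 G B tau k : lattice_basis G B ->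
  (0 < k)%N -> (k <= d)%N -> 0 < successive_min (box tau) G k.
Proof.
move=> GB k0 kd; have [c c0 cP] := lattice_admissible_gt0 tau GB.
rewrite successive_minE; apply: lt_le_trans c0 _.
apply: lb_le_inf; first exact: lattice_admissible_nonempty GB kd.
by move=> lam /(cP _ _ k0).
Qed.

Lemma successive_min_mono G B tau k l : lattice_basis G B ->
  (k <= l)%N -> (l <= d)%N ->
  successive_min (box tau) G k <= successive_min (box tau) G l.
Proof.
move=> GB kl ld; rewrite [leRHS]successive_minE; apply: lb_le_inf.
  exact: lattice_admissible_nonempty GB ld.
by move=> lam /(admissible_le kl) /successive_min_le.
Qed.

Lemma log_min_mono G B tau k l : lattice_basis G B ->
  (0 < k)%N -> (k <= l)%N -> (l <= d)%N -> log_min k tau G <= log_min l tau G.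
Proof.
move=> GB k0 kl ld; rewrite /log_min ler_ln ?posrE.
- exact: successive_min_mono GB kl ld.
- exact: successive_min_gt0 GB k0 (leq_trans kl ld).
- exact: successive_min_gt0 GB (leq_trans k0 kl) ld.
Qed.

Lemma sum_ln n (F : 'I_n -> R) : (forall i, 0 < F i) ->
  \sum_i ln (F i) = ln (\prod_i F i).
Proof.
move=> F0; suff [] : 0 < \prod_i F i /\ \sum_i ln (F i) = ln (\prod_i F i) by [].
elim/big_ind2 : _ => [|x x' y y' [x0 ->] [y0 ->]|i _]; rewrite ?ln1 //.
by rewrite mulr_gt0 // lnM.
Qed.

(** The product of the minima is at most that of the reduced norms. The constant depends on [d]
    alone, so it serves the lattice and its dual at every [tau]. *)
Lemma sum_log_min_le : exists C : R, forall G tau,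
  unimodular_lattice G -> zero_sum tau ->
  \sum_(i < d) log_min i.+1 tau G <= C.
Proof.
have [C C0 CP] := lattice_admissible_prod; exists (ln C) => G tau [B GB dB] tau0.
have [r [rP /(_ dB tau0) rC]] := CP G B tau GB.
have s0 (i : 'I_d) : 0 < successive_min (box tau) G i.+1.
  exact: successive_min_gt0 GB _ (ltn_ord i).
rewrite /log_min sum_ln // ler_ln ?posrE //; last by apply: prodr_gt0 => i _.
apply: le_trans rC; apply: ler_prod => i _.
by rewrite (ltW (s0 i)) successive_min_le.
Qed.

(** The inverse transpose of a basis is a basis of the dual: the coordinates of [y] in it are its
    pairings with the rows of [B], which are integers. *)
Lemma dual_unimodular G :
  unimodular_lattice G -> unimodular_lattice (dual_lattice G).
Proof.
move=> [B [uB GB] dB]; exists (invmx B)^T; last first.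
  by rewrite det_tr det_inv normfV dB invr1.
split; first by rewrite unitmx_tr unitmx_inv.
apply/seteqP; split => [y yG | _ [z _ <-] x].
  have yi i : \sum_j y 0 j * B i j \is a Num.int.
    have : G (row i B).
      rewrite GB; exists (delta_mx 0 i) => //.
      by rewrite map_delta_mx -rowE.
    by move/yG; under eq_bigr do rewrite mxE.
  exists (\row_i Num.floor (\sum_j y 0 j * B i j)) => //.
  have -> : map_mx intr (\row_i Num.floor (\sum_j y 0 j * B i j)) = y *m B^T.
    apply/rowP => i; rewrite !mxE /= floorK //; apply: eq_bigr => j _.
    by rewrite mxE.
  by rewrite -mulmxA -trmx_mul mulVmx // trmx1 mulmx1.
rewrite GB => -[w _ <-].
have -> : \sum_i (map_mx intr z *m (invmx B)^T) 0 i * (map_mx intr w *m B) 0 i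
    = ((map_mx intr z *m (invmx B)^T) *m (map_mx intr w *m B)^T) 0 0.
  by rewrite [RHS]mxE; apply: eq_bigr => i _; congr (_ * _); rewrite [RHS]mxE.
rewrite trmx_mul mulmxA -[X in X *m _]mulmxA -trmx_mul mulmxV // trmx1 mulmx1.
rewrite mxE rpred_sum // => i _; rewrite !mxE rpredM //; exact: intr_int.
Qed.

(** A nonzero dual vector pairs nontrivially with one of [d] independent lattice vectors. The
    pairing is a nonzero integer, and each of its [d] terms is at most [lam * mu] because the
    factors [expR] of [tau] and [- tau] cancel. *)
Lemma transference G tau (lam mu : R) :
  admissible tau G d lam -> admissible (- tau) (dual_lattice G) 1 mu ->
  1 <= d%:R * lam * mu.
Proof.
move=> [lam0 [V fV VP]] [mu0 [Y fY YP]].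
have [yG yle] := YP 0.
have [i Vi] : exists i, (V *m Y^T) i 0 != 0.
  apply/existsP; apply: contraT; rewrite negb_exists => /forallP h.
  have VY0 : V *m Y^T = 0.
    by apply/colP => i; rewrite [RHS]mxE; apply/eqP; have := h i; rewrite negbK.
  have Y0 : Y = 0.
    apply: trmx_inj; rewrite trmx0 -[Y^T](mulKmx (_ : V \in unitmx)) ?VY0 ?mulmx0 //.
    by rewrite -row_free_unit.
  by move: fY; rewrite Y0 /row_free mxrank0.
have [Gi Vle] := VP i.
have e : (V *m Y^T) i 0 = \sum_j row 0 Y 0 j * row i V 0 j.
  by rewrite mxE; apply: eq_bigr => j _; rewrite !mxE mulrC.
have : (V *m Y^T) i 0 \is a Num.int by rewrite e; exact: yG.
move=> /norm_intr_ge1/(_ Vi).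
move=> /le_trans; apply; rewrite mxE; apply: le_trans (ler_norm_sum _ _ _) _.
have -> : d%:R * lam * mu = \sum_(j < d) lam * mu.
  by rewrite sumr_const card_ord -[RHS]mulr_natl mulrA.
apply: ler_sum => j _; rewrite normrM mxE.
have -> : lam * mu = (lam * expR (tau 0 j)) * (mu * expR ((- tau) 0 j)).
  by rewrite mxE expRN; field; rewrite gt_eqF ?expR_gt0.
by apply: ler_pM.
Qed.

Lemma log_transference G tau : (0 < d)%N -> unimodular_lattice G ->
  - log_min d tau G <= log_min 1 (- tau) (dual_lattice G) + ln d%:R.
Proof.
move=> d0 uG; have [B GB _] := uG; have [B' GB' _] := dual_unimodular uG.
have s0 := successive_min_gt0 tau GB d0 (leqnn d).
have s'0 := successive_min_gt0 (- tau) GB' (ltnSn 0) d0.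
have dR : 0 < d%:R :> R by rewrite ltr0n.
rewrite /log_min -lnV ?posrE // -lnM ?posrE // ler_ln ?posrE ?invr_gt0 ?mulr_gt0 //.
rewrite -[leLHS]mul1r ler_pdivrMr // -mulrA -ler_pdivrMr ?mulr_gt0 //.
(* The product bound passes to the infima one factor at a time, first over [mu], then over [lam]. *)
rewrite [leRHS]successive_minE; apply: lb_le_inf.
  exact: lattice_admissible_nonempty GB' d0.
move=> mu muP; have mu0 : 0 < mu by case: muP.
rewrite ler_pdivrMr ?mulr_gt0 // mulrA -ler_pdivrMl ?mulr_gt0 //.
rewrite [leRHS]successive_minE; apply: lb_le_inf.
  exact: lattice_admissible_nonempty GB (leqnn d).
move=> lam lamP; rewrite ler_pdivrMl ?mulr_gt0 //.
by have := transference lamP muP; rewrite [mu * _]mulrC mulrAC.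
Qed.

End SuccessiveMinima.

(** * Averages of logarithmic minima, the weight, and lower limits *)

Section LowerPsi.
Variables (R : realType) (d : nat).
Implicit Types (G : set 'rV[R]_d) (tau : 'rV[R]_d) (f : 'rV[R]_d -> R).

Lemma sum_log_minE k tau G :
  \sum_(1 <= j < k.+1) log_min j tau G = \sum_(i < k) log_min i.+1 tau G.
Proof. by rewrite big_add1 big_mkord. Qed.

Lemma log_min_bounds : (0 < d)%N -> exists2 C : R, 0 <= C &
  forall G tau, unimodular_lattice G -> zero_sum tau ->
    log_min 1 tau G <= C /\
    \sum_(1 <= j < d) log_min j tau G
      <= log_min 1 (- tau) (dual_lattice G) + C.
Proof.
move=> d0; have [C CP] := sum_log_min_le R d.
have lnd : 0 <= ln d%:R :> R by rewrite ln_ge0 // ler1n.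
exists (`|C| + ln d%:R); first by rewrite addr_ge0.
move=> G tau uG tau0; have CG := CP _ _ uG tau0; split.
  have dR : 1 <= d%:R :> R by rewrite ler1n.
  have [B GB _] := uG.
  have : d%:R * log_min 1 tau G <= C.
    apply: le_trans CG.
    have -> : d%:R * log_min 1 tau G = \sum_(i < d) log_min 1 tau G.
      by rewrite sumr_const card_ord mulr_natl.
    by apply: ler_sum => i _; apply: log_min_mono GB _ _ _.
  by have := ler_norm C; have := normr_ge0 C; nra.
have := log_transference tau d0 uG.
move: CG; rewrite -sum_log_minE big_nat_recr //=.
by have := ler_norm C; lra.
Qed.

(** The new term [L_(k+1)] is at least the mean of the first [k] terms. *)
Lemma mean_log_min_le G k tau : unimodular_lattice G -> (0 < k)%N -> (k < d)%N ->
  k.+1%:R / k%:R * \sum_(1 <= j < k.+1) log_min j tau G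
    <= \sum_(1 <= j < k.+2) log_min j tau G.
Proof.
move=> [B GB _] k0 kd; have kR : 0 < k%:R :> R by rewrite ltr0n.
rewrite [leRHS]big_nat_recr //=; set S := \sum_(1 <= j < k.+1) _.
have -> : k.+1%:R / k%:R * S = S + S / k%:R.
  by rewrite -natr1; field; rewrite gt_eqF.
rewrite lerD2l ler_pdivrMr // mulr_natr /S sum_log_minE.
have -> : log_min k.+1 tau G *+ k = \sum_(i < k) log_min k.+1 tau G.
  by rewrite sumr_const card_ord.
apply: ler_sum => i _.
by apply: log_min_mono GB _ _ kd => //; apply: leqW; exact: ltn_ord.
Qed.

Lemma coord_le_max tau k : tau 0 k <= max_coord tau.
Proof.
apply: ub_le_sup; last by exists k.
by exists `|tau| => _ [j _ <-]; apply: le_trans (ler_norm _) (row_norm_coord _ _).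
Qed.

Lemma max_coord_le tau (c : R) : (0 < d)%N ->
  (forall k, tau 0 k <= c) -> max_coord tau <= c.
Proof.
move=> d0 tc; apply: ge_sup; last by move=> _ [k _ <-].
by exists (tau 0 (Ordinal d0)); exists (Ordinal d0).
Qed.

(** Minus one coordinate is the sum of the [d - 1] others; this is the source of the factor
    [d - 1]. *)
Lemma oppr_coord_le tau k : zero_sum tau -> - tau 0 k <= (d - 1)%:R * max_coord tau.
Proof.
move=> /eqP; rewrite (bigD1 k) //= addr_eq0 => /eqP ->; rewrite opprK.
have -> : (d - 1)%:R * max_coord tau = \sum_(i < d | i != k) max_coord tau.
  by rewrite sumr_const cardC1 card_ord subn1 mulr_natl.
by apply: ler_sum => i _; exact: coord_le_max.
Qed.

Lemma max_coord_ge0 tau : (0 < d)%N -> zero_sum tau -> 0 <= max_coord tau.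
Proof.
move=> d0 t0; have := oppr_coord_le (Ordinal d0) t0.
have := coord_le_max tau (Ordinal d0).
have : d%:R = (d - 1)%:R + 1 :> R by rewrite natr1 subn1 prednK.
have : 0 < d%:R :> R by rewrite ltr0n.
nra.
Qed.

Lemma max_coordN_le tau : (0 < d)%N -> zero_sum tau ->
  max_coord (- tau) <= (d - 1)%:R * max_coord tau.
Proof.
by move=> d0 t0; apply: max_coord_le => // k; rewrite mxE; exact: oppr_coord_le.
Qed.

Lemma norm_le_max_coord tau : (2 <= d)%N -> zero_sum tau ->
  `|tau| <= (d - 1)%:R * max_coord tau.
Proof.
move=> d2 t0; have m0 := max_coord_ge0 (ltnW d2) t0.
have c1 : 1 <= (d - 1)%:R :> R by rewrite ler1n subn_gt0.
apply/row_norm_leP => [|k]; first by rewrite mulr_ge0.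
have := coord_le_max tau k; have := oppr_coord_le k t0.
by rewrite ler_norml; nra.
Qed.

Lemma max_coord_gt0 tau : (2 <= d)%N -> zero_sum tau -> 0 < `|tau| ->
  0 < max_coord tau.
Proof.
move=> d2 t0 tn; rewrite lt_neqAle max_coord_ge0 ?(ltnW d2) // andbT eq_sym.
by apply: contraTneq tn => m0; rewrite -leNgt -[0](mulr0 (d - 1)%:R) -m0 norm_le_max_coord.
Qed.

(** A number strictly below a supremum of infima is below one of them. With [lower_Psi_ge], this
    reduces comparisons of lower limits to real quotients at large [tau]. *)
Lemma lower_Psi_eventually k G f (a : R) : (a%:E < lower_Psi k G f)%E ->
  exists M : R, forall tau, zero_sum tau -> M < `|tau| ->
    a <= (\sum_(1 <= j < k.+1) log_min j tau G) / f tau.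
Proof.
rewrite /lower_Psi limf_einfE => /ereal_sup_gt[_ [V [M MV] <-] aV].
exists M => tau t0 tM; rewrite -lee_fin; apply: le_trans (ltW aV) _.
by apply: ereal_inf_lbound; exists tau => //; exact: MV.
Qed.

Lemma lower_Psi_ge k G f (a : R) :
  (exists M : R, forall tau, zero_sum tau -> M < `|tau| ->
    a <= (\sum_(1 <= j < k.+1) log_min j tau G) / f tau) ->
  (a%:E <= lower_Psi k G f)%E.
Proof.
move=> [M MP]; rewrite /lower_Psi limf_einfE.
pose V := [set tau | a <= (\sum_(1 <= j < k.+1) log_min j tau G) / f tau].
apply: le_trans (ereal_sup_ubound _); last first.
  by exists V => //; exists M => tau tM t0; exact: MP.
by apply: le_ereal_inf_tmp => _ [tau /= tV <-]; rewrite lee_fin.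
Qed.

End LowerPsi.

(** The lower limits are extended reals, so the comparison is tested on real [a] below [X]; the
    slack [eps] leaves room for bounded error terms. *)
Lemma lee_div_approx (R : realType) (p q : R) (X Y : \bar R) : 0 < p -> 0 < q ->
  (forall a eps : R, 0 < eps -> (a%:E < X)%E -> ((q / p * a - eps)%:E <= Y)%E) ->
  (X / p%:E <= Y / q%:E)%E.
Proof.
move=> p0 q0 h; rewrite !inver !gt_eqF // lee_pdivlMr // -muleA -EFinM mulrC.
have c0 : 0 < q / p by rewrite divr_gt0.
move: X h => [x||] h.
- rewrite -EFinM [x * _]mulrC; apply/lee_addgt0Pr => e e0.
  (* This [a] makes [q / p * a - e / 2] equal to [q / p * x - e]. *)
  have := h (x - e / 2 / (q / p)) (e / 2).
  rewrite lte_fin ltrBlDr ltrDl !divr_gt0 // => /(_ isT isT).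
  rewrite mulrBr [_ * (_ / (q / p))]mulrC divfK ?gt_eqF // -leeBlDr //.
  by rewrite -EFinB -addrA -opprD -splitr.
- rewrite gt0_mulye ?lte_fin //; move: Y h => [y||] h //.
    (* A finite [Y = y] would satisfy [y + 1 <= y]. *)
    have := h ((y + 2) / (q / p)) 1 ltr01 (ltry _).
    by rewrite mulrC divfK ?gt_eqF // lee_fin => ?; exfalso; lra.
  by have := h 0 1 ltr01 (ltry _).
- by rewrite gt0_mulNye ?lte_fin // leNye.
Qed.

Theorem theorem5 (R : realType) (d : nat) (hd : (2 <= d)%N)
    (Lambda : set 'rV[R]_d) (hLambda : unimodular_lattice Lambda)
    (f : 'rV[R]_d -> R) (hf : forall tau, zero_sum tau -> f tau = max_coord tau) :
  (forall k : nat, (1 <= k)%N -> (k + 1 <= d - 1)%N ->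
     (lower_Psi k Lambda f / k%:R%:E <=
      lower_Psi (k + 1) Lambda f / (k + 1)%:R%:E)%E) /\
  (lower_Psi (d - 1) Lambda f / (d - 1)%:R%:E <=
   lower_Psi 1 (dual_lattice Lambda) f / ((d - 1) ^ 2)%:R%:E)%E.
Proof.
have d0 := ltnW hd.
split=> [k k1 kd|].
  have kd' : (k < d)%N by rewrite -addn1 (leq_trans kd) // leq_subr.
  apply: lee_div_approx; rewrite ?ltr0n ?addn1 // => a e e0.
  move=> /lower_Psi_eventually[M MP]; apply: lower_Psi_ge.
  exists (Num.max M 0) => tau t0; rewrite gt_max => /andP[tM tn].
  have F0 : 0 < f tau by rewrite hf // max_coord_gt0.
  have := mean_log_min_le tau hLambda k1 kd'; have := MP _ t0 tM.
  rewrite !ler_pdivlMr // => h1 h2; apply: le_trans h2.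
  have c0 : 0 < k.+1%:R / k%:R :> R by rewrite divr_gt0 ?ltr0n.
  by nra.
have d1 : (0 < d - 1)%N by rewrite subn_gt0.
have [C C0 CP] := log_min_bounds R d0.
set c : R := (d - 1)%:R.
have c0 : 0 < c by rewrite ltr0n.
apply: lee_div_approx; rewrite ?ltr0n ?expn_gt0 ?d1 // => a e e0.
move=> /lower_Psi_eventually[M MP]; apply: lower_Psi_ge.
(* As [|sig| <= c * f (- sig)], this threshold makes [e * f (- sig)] exceed [c * (2 * C)]. *)
exists (Num.max M (c ^+ 2 * (2 * C) / e)) => sig s0.
rewrite gt_max => /andP[sM sC].
(* The dual lattice is taken at [sig], hence [Lambda] at [- sig], which has the same norm. *)
have s'0 : zero_sum (- sig).
  rewrite /zero_sum /=; under eq_bigr do rewrite mxE.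
  by rewrite sumrN s0 oppr0.
have sn : 0 < `|sig|.
  by apply: le_lt_trans sC; rewrite divr_ge0 ?mulr_ge0 ?(ltW e0) ?exprn_ge0 ?(ltW c0).
have F0 : 0 < f sig by rewrite hf // max_coord_gt0.
have F'0 : 0 < f (- sig) by rewrite hf // max_coord_gt0 ?normrN.
have FF : f (- sig) <= c * f sig by rewrite !hf // max_coordN_le.
have sF : `|sig| <= c * f (- sig) by rewrite hf // -normrN norm_le_max_coord.
have := MP _ s'0; rewrite normrN => /(_ sM).
have [_] := CP _ _ hLambda s'0; rewrite opprK.
have [+ _] := CP _ _ (dual_unimodular hLambda) s0.
rewrite subn1 prednK // big_nat1 ler_pdivlMr // ler_pdivlMr //.
set L := log_min 1 sig _; set S := \sum_(1 <= j < d) _ => LC SL aS.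
have -> : (d.-1 ^ 2)%:R / c = c.
  by rewrite natrX -subn1 -/c expr2 mulfK // gt_eqF.
move: sC; rewrite ltr_pdivrMr // => sC.
set F := f sig in F0 FF *; set F' := f (- sig) in F'0 FF sF aS *.
(* [L - C] is nonpositive, so it may be divided by [c * F] instead of [F'];
   the remaining term [2 * C] is absorbed by [e]. *)
have h1 : c * a * F' <= c * (L - C) + c * (2 * C).
  by rewrite -mulrA -mulrDr ler_pM2l //; lra.
have h2 : c * (2 * C) <= e * F'.
  have eF : c * (e * F') = c * F' * e by ring.
  have cC : c * (c * (2 * C)) = c ^+ 2 * (2 * C) by ring.
  rewrite -(ler_pM2l c0) eF cC; apply: ltW; apply: lt_le_trans sC _.
  by rewrite ler_pM2r.
have h3 : (c * a - e) * F' <= c * (L - C) by lra.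
have [ca|ca] := leP (c * a - e) 0.
  have h4 : (c * a - e) * (c * F) <= (c * a - e) * F' by rewrite ler_wnM2l.
  have : c * ((c * a - e) * F) <= c * (L - C).
    by apply: le_trans h3; rewrite mulrCA.
  by rewrite ler_pM2l //; lra.
(* A positive [c * a - e] would contradict [L <= C]. *)
have : 0 < c * (L - C) by apply: lt_le_trans h3; rewrite mulr_gt0.
by rewrite pmulr_rgt0 //; lra.
Qed.
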